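(* Let $p\in\mathbb{C}[z]$ be a polynomial of degree $n\ge 2$ with roots $\{\lambda_j\}_{j=1}^n$, let $\{\mu_j\}_{j=1}^{n-1}$ be the roots of $p'$ (roots listed with multiplicity), and put $\mu_n:=\frac1n\sum_{j=1}^n\lambda_j$. Let $k\in\{1,\ldots,n-1\}$, $a:=\binom{n-1}{k}$, $b:=\binom{n}{k}$. Then there exists a unitary-stochastic matrix $S_k=(s_{ijk})_{i,j=1}^b\in M_b(\mathbb{R})$ such that $$\sum_{i=a+1}^{b}s_{ijk}=\frac kn\qquad\text{for all } j\in\{1,\ldots,b\}$$ and, for all $\alpha\in\mathbb{C}$, $$C_k(\{\mu_j-\alpha\}_{j=1}^{n-1})=P\,S_k\,C_k(\{\lambda_j-\alpha\}_{j=1}^{n}),$$ where $P:\mathbb{C}^b\to\mathbb{C}^a$ is the natural orthoprojection onto the first $a$ coordinates. In particular, for $k=1$ there exists a unitary-stochastic matrix $S_1=(s_{ij1})\in M_n(\mathbb{R})$ such that $s_{nj1}=1/n$ for all $j\in\{1,\ldots,n\}$ and $(\mu_1,\ldots,\mu_n)^T=S_1(\lambda_1,\ldots,\lambda_n)^T$.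
   Context: A matrix $S\in M_N(\mathbb{R})$ is unitary-stochastic if $S=U\circ\overline U$ (entrywise product) for some unitary $U=(u_{ij})\in M_N(\mathbb{C})$, i.e. its entries are $|u_{ij}|^2$. For a vector $\{z_j\}_{j=1}^N\in\mathbb{C}^N$ and $1\le k\le N$, $C_k(\{z_j\}_{1}^N):=\{z_{i_1}\cdots z_{i_k}\}_{1\le i_1<\ldots<i_k\le N}\in\mathbb{C}^{\binom{N}{k}}$, with the $k$-subsets listed in a fixed order. *)

(* Defs.v *)
From HB Require Import structures.
From mathcomp Require Import all_boot all_order all_algebra.
From mathcomp Require Import reals complex.

Set Implicit Arguments.
Unset Strict Implicit.
Unset Printing Implicit Defensive.

Import Order.TTheory GRing.Theory Num.Theory.

Local Open Scope ring_scope.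

(* [Num.conj] on [R[i]] is complex conjugation, so entrywise [S = U o conj U]. *)
Definition unitary_stochastic (R : realType) (N : nat) (S : 'M[R]_N) : Prop :=
  exists2 U : 'M[R[i]]_N, U \is unitarymx &
    map_mx (real_complex R) S = map2_mx *%R U (map_mx Num.conj U).

(* Every complex number occurs in the family [z] exactly as often as its
   multiplicity as a root of [p], which is 0 for a non-root.  Meant for
   [p != 0] only. *)
Definition roots_with_mult (R : realType) (p : {poly R[i]}) (N : nat)
    (z : 'I_N -> R[i]) : Prop :=
  forall x : R[i], #|[set j | z j == x]| = mup x p.

(* [e] lists every [k]-subset of ['I_N] exactly once; the order is arbitrary. *)
Definition ksubset_listing (N k : nat) (e : 'I_'C(N, k) -> {set 'I_N}) : Prop :=
  injective e /\ forall A : {set 'I_N}, #|A| = k <-> exists i, e i = A.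

Definition compound (R : realType) (N k : nat) (e : 'I_'C(N, k) -> {set 'I_N})
    (z : 'I_N -> R[i]) : 'cV[R[i]]_('C(N, k)) :=
  \col_i \prod_(j in e i) z j.

(* Main.v *)
Require Import Defs.
From HB Require Import structures.
From mathcomp Require Import all_boot all_order all_algebra.
From mathcomp Require Import perm.
From mathcomp Require Import reals complex.

(* Let D = diag(lambda) and let e be a unit vector all of whose coordinates have
   modulus n^(-1/2).  The compression of D to the orthogonal of e has
   characteristic polynomial p' / (n lead_coef p), so by Schur there is a unitary
   V, with last row flat, such that the leading block of V D V^* is triangular
   with diagonal mu.  By Cauchy-Binet the k-th compound of V is unitary, and
   S_k consists of its squared moduli: the principal minors of the triangular
   block of V (D - alpha) V^* are on the one hand products of the mu_j - alpha,
   on the other hand sums of |minor of V|^2 times products of the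
   lambda_j - alpha. *)

Set Implicit Arguments.
Unset Strict Implicit.
Unset Printing Implicit Defensive.

Import Order.TTheory GRing.Theory Num.Theory.

Local Open Scope ring_scope.
Local Open Scope sesquilinear_scope.

(** * Minors and the Cauchy-Binet formula *)

(* Junk value ord0 past the end of [J]: only used with #|J| = k. *)
Definition elt n k (J : {set 'I_n.+1}) (i : 'I_k) : 'I_n.+1 :=
  nth ord0 (enum J) i.

(** The size [k] is an argument of its own, not [#|I|], so that minors on different index sets are
    determinants of matrices of one and the same square type. *)
Definition minor (R : comPzRingType) m n k (I : {set 'I_m.+1})
    (J : {set 'I_n.+1}) (A : 'M[R]_(m.+1, n.+1)) : R :=
  \det (mxsub (elt I : 'I_k -> _) (elt J) A).

Lemma mem_elt n k (J : {set 'I_n.+1}) (i : 'I_k) : #|J| = k -> elt J i \in J.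
Proof. by move=> cJ; rewrite -mem_enum mem_nth // -cardE cJ. Qed.

Lemma elt_inj n k (J : {set 'I_n.+1}) :
  #|J| = k -> injective (elt J : 'I_k -> _).
Proof.
move=> cJ i j /eqP; rewrite nth_uniq ?enum_uniq -?cardE ?cJ // => /eqP.
exact: val_inj.
Qed.

Lemma imset_elt n k (J : {set 'I_n.+1}) :
  #|J| = k -> [set elt J i | i : 'I_k] = J.
Proof.
move=> cJ; apply/eqP; rewrite eqEcard card_imset; last exact: elt_inj.
rewrite card_ord cJ leqnn andbT; apply/subsetP => _ /imsetP[i _ ->].
exact: mem_elt.
Qed.

Lemma prod_elt (R : comPzRingType) n k (J : {set 'I_n.+1}) (F : 'I_n.+1 -> R) :
  #|J| = k -> \prod_(i < k) F (elt J i) = \prod_(j in J) F j.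
Proof.
move=> cJ; rewrite -[in RHS](imset_elt cJ) big_imset //=.
by move=> ? ? _ _; exact: elt_inj.
Qed.

Lemma sum_elt (R : nmodType) n k (J : {set 'I_n.+1}) (F : 'I_n.+1 -> R) :
  #|J| = k -> \sum_(i < k) F (elt J i) = \sum_(j in J) F j.
Proof.
move=> cJ; rewrite -[in RHS](imset_elt cJ) big_imset //=.
by move=> ? ? _ _; exact: elt_inj.
Qed.

Lemma det_mulmx_ffun (R : comPzRingType) k n (A : 'M[R]_(k, n))
    (B : 'M[R]_(n, k)) :
  \det (A *m B) =
  \sum_(f : {ffun 'I_k -> 'I_n}) (\prod_i A i (f i)) * \det (rowsub f B).
Proof.
rewrite /determinant; under [RHS]eq_bigr do rewrite mulr_sumr.
rewrite exchange_big /=; apply: eq_bigr => s _.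
under eq_bigr do rewrite mxE.
rewrite bigA_distr_bigA /= mulr_sumr; apply: eq_bigr => f _.
rewrite big_split /= mulrCA; congr (_ * (_ * _)).
by apply: eq_bigr => i _; rewrite mxE.
Qed.

Lemma det_rowsub_noninj (R : comPzRingType) k n (f : {ffun 'I_k -> 'I_n})
    (B : 'M[R]_(n, k)) : ~~ injectiveb f -> \det (rowsub f B) = 0.
Proof.
move=> /injectivePn[i [j neq_ij eq_f]].
by apply: (determinant_alternate neq_ij) => l; rewrite !mxE eq_f.
Qed.

(** In the expansion over all maps [f], non-injective ones repeat a row and vanish. The others are
    grouped by their image [J]: each is [elt J] after a permutation, whose sign supplies the
    determinant of the columns of [A] in [J]. *)
Theorem Cauchy_Binet (R : comPzRingType) k n (A : 'M[R]_(k, n.+1))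
    (B : 'M[R]_(n.+1, k)) :
  \det (A *m B) = \sum_(J : {set 'I_n.+1} | #|J| == k)
    \det (colsub (elt J) A) * \det (rowsub (elt J) B).
Proof.
rewrite det_mulmx_ffun (bigID (fun f : {ffun _} => injectiveb f)) /=.
rewrite [X in _ + X]big1 ?addr0 => [|f /det_rowsub_noninj->]; last first.
  by rewrite mulr0.
rewrite (partition_big (fun f : {ffun _} => [set f i | i : 'I_k])
  (fun J => #|J| == k)) => [|f /injectiveP f_inj] /=; last first.
  by rewrite card_imset // card_ord.
apply: eq_bigr => J /eqP cJ; have eJ := elt_inj cJ.
pose h (s : 'S_k) : {ffun 'I_k -> 'I_n.+1} := [ffun i => elt J (s i)].
have h_inj s : injective (h s).
  by move=> i j; rewrite !ffunE => /eJ /perm_inj.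
have imh s : [set h s i | i : 'I_k] = J.
  apply/eqP; rewrite eqEcard card_imset // card_ord cJ leqnn andbT.
  by apply/subsetP => _ /imsetP[i _ ->]; rewrite ffunE mem_elt.
(* The inverse of [h] sends [i] to the position of [f i] in [J]. Both defaults, [i] and the
   identity, are unreachable when [f] is injective with image [J]. *)
pose h' (f : {ffun 'I_k -> 'I_n.+1}) : 'S_k :=
  insubd (1%g : {perm 'I_k}) [ffun i => odflt i [pick j | elt J j == f i]].
have hK (f : {ffun 'I_k -> 'I_n.+1}) :
    injectiveb f && ([set f i | i : 'I_k] == J) -> h (h' f) = f.
  move=> /andP[/injectiveP f_inj /eqP imf].
  have h'E i : elt J ([ffun i => odflt i [pick j | elt J j == f i]] i) = f i.
    rewrite ffunE; case: pickP => [j /eqP //|noj].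
    have: f i \in J by rewrite -imf imset_f.
    rewrite -(imset_elt cJ) => /imsetP[j _ eqj].
    by have := noj j; rewrite eqj eqxx.
  apply/ffunP => i; rewrite ffunE -h'E; congr elt.
  rewrite -pvalE insubdK //.
  apply/injectiveP => a b eq_ab; apply: f_inj.
  by rewrite -!h'E eq_ab.
rewrite (reindex_onto h h' hK) /=.
rewrite (eq_bigl predT) => [|s]; last first.
  rewrite imh eqxx andbT; have/injectiveP-> := @h_inj s.
  rewrite /=; apply/eqP/permP => i; apply: eJ.
  have /ffunP/(_ i) : h (h' (h s)) = h s.
    by apply: hK; rewrite imh eqxx andbT; apply/injectiveP.
  by rewrite !ffunE.
rewrite [in RHS]/determinant mulr_suml; apply: eq_bigr => s _.
have -> : rowsub (h s) B = row_perm s (rowsub (elt J) B).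
  by apply/matrixP => i j; rewrite !mxE ffunE.
rewrite row_permE det_mulmx det_perm mulrCA mulrA; congr (_ * _ * _).
by apply: eq_bigr => i _; rewrite !mxE ffunE.
Qed.

Lemma minorM (R : comPzRingType) m n p k (I : {set 'I_m.+1}) (J : {set 'I_p.+1})
    (A : 'M[R]_(m.+1, n.+1)) (B : 'M[R]_(n.+1, p.+1)) :
  minor k I J (A *m B) =
  \sum_(K : {set 'I_n.+1} | #|K| == k) minor k I K A * minor k K J B.
Proof.
rewrite /minor.
have -> : mxsub (elt I) (elt J) (A *m B) =
   rowsub (elt I) A *m colsub (elt J) B :> 'M_k.
  by apply/matrixP => i j; rewrite !mxE; apply: eq_bigr => l _; rewrite !mxE.
rewrite Cauchy_Binet; apply: eq_bigr => K _.
by congr (_ * _); apply: (congr1 (@determinant R k)); apply/matrixP => i j;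
  rewrite !mxE.
Qed.

Lemma minor_diag (R : comPzRingType) n k (I J : {set 'I_n.+1})
    (d : 'rV[R]_n.+1) :
  #|I| = k -> #|J| = k ->
  minor k I J (diag_mx d) = if I == J then \prod_(i in I) d 0 i else 0.
Proof.
move=> cI cJ; have [<-|neq_IJ] := eqVneq I J.
  transitivity (\det (diag_mx (\row_(i < k) d 0 (elt I i)))).
    congr (\det _); apply/matrixP => i j; rewrite !mxE.
    by rewrite (inj_eq (elt_inj cI)).
  by rewrite det_diag -(prod_elt _ cI); apply: eq_bigr => i _; rewrite mxE.
(* Distinct sets of equal size are not nested, and the row of an element of [I] outside [J] is
   zero. *)
have /subsetPn[x xI xJ] : ~~ (I \subset J).
  by apply: contra neq_IJ => sIJ; rewrite eqEcard sIJ cI cJ leqnn.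
have /imsetP[i _ eq_x] : x \in [set elt I i | i : 'I_k] by rewrite imset_elt.
rewrite /minor (expand_det_row _ i) big1 // => j _; rewrite !mxE.
rewrite -eq_x; case: eqP => [xE|]; last by rewrite mulr0n mul0r.
by case/negP: xJ; rewrite xE mem_elt.
Qed.

(** * Special determinants and the derivative of a product *)

Lemma det_rank_trig (R : comPzRingType) k (A : 'M[R]_k) (r : 'I_k -> nat) :
    injective r -> (forall i j, (r i < r j)%N -> A i j = 0) ->
  \det A = \prod_i A i i.
Proof.
(* A permutation other than 1 raises the rank somewhere, and so meets a zero. *)
move=> r_inj A0; rewrite /determinant (bigD1 (1%g : {perm 'I_k})) //= odd_perm1 mul1r.
rewrite [X in _ + X]big1 ?addr0 => [|s s_neq1]; last first.
  suff /existsP[i lt_i] : [exists i, (r i < r (s i))%N].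
    by rewrite (bigD1 i) //= A0 // mul0r mulr0.
  apply: contraNT s_neq1; rewrite negb_exists => /forallP le_s.
  have le_r i : true -> (r (s i) <= r i ?= iff (r (s i) == r i))%N.
    by split=> //; rewrite leqNgt.
  have [_] := leqif_sum le_r.
  have -> : (\sum_i r i = \sum_i r (s i))%N.
    by rewrite (reindex_inj (@perm_inj _ s)).
  rewrite eqxx => /esym/forallP eq_r.
  by apply/eqP/permP => i; rewrite perm1; apply/r_inj/eqP/eq_r.
by apply: eq_bigr => i _; rewrite perm1.
Qed.

Lemma det_1_sub_colrow (R : comPzRingType) k (u : 'cV[R]_k) (v : 'rV[R]_k) :
  \det (1%:M - u *m v) = 1 - (v *m u) 0 0.
Proof.
(* Two triangular factorisations of the block matrix [1, v; u, 1]. *)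
have detE (A B : 'M[R]_(1 + k)) : A = B -> \det A = \det B by move->.
have := detE (block_mx 1%:M 0 u 1%:M *m block_mx 1%:M v 0 (1%:M - u *m v))
  (block_mx (1%:M - v *m u) v 0 1%:M *m block_mx 1%:M 0 u 1%:M).
rewrite !det_mulmx !det_lblock !det_ublock !det1 !mul1r !mulr1 => ->.
  by rewrite det_mx11 !mxE.
rewrite !mulmx_block !(mul1mx, mulmx1, mul0mx, mulmx0, addr0, add0r).
by rewrite subrK addrC subrK.
Qed.

Lemma deriv_prod (R : comNzRingType) (I : finType) (F : I -> {poly R}) :
  (\prod_i F i)^`() = \sum_j (F j)^`() * \prod_(i | i != j) F i.
Proof.
(* Induction runs over duplicate-free sequences, where [i != j] drops exactly one factor. *)
suff deriv_uniq (r : seq I) : uniq r -> (\prod_(i <- r) F i)^`() =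
    \sum_(j <- r) (F j)^`() * \prod_(i <- r | i != j) F i.
  by rewrite deriv_uniq // index_enum_uniq.
elim: r => [|a r IHr] /=; first by rewrite !big_nil derivC.
case/andP=> ar /IHr{}IHr; rewrite !big_cons derivM IHr eqxx /=; congr (_ * _ + _).
  rewrite big_seq [RHS]big_seq_cond; apply: eq_bigl => i.
  by case: eqP => [->|]; rewrite ?(negPf ar) ?andbT.
rewrite mulr_sumr big_seq [RHS]big_seq; apply: eq_bigr => j jr.
rewrite big_cons mulrCA; case: eqP => // eq_aj.
by rewrite -eq_aj (negPf ar) in jr.
Qed.

Lemma minor1 (R : comPzRingType) n k (I J : {set 'I_n.+1}) :
  #|I| = k -> #|J| = k -> minor k I J (1%:M : 'M[R]_n.+1) = (I == J)%:R.
Proof.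
move=> cI cJ; rewrite -diag_const_mx minor_diag //; case: eqP => // _.
by rewrite big1 // => i _; rewrite mxE.
Qed.

(** * Unitary matrices, the flat vector and the compression *)

Section Unitary.
Variable C : numClosedFieldType.

Lemma minor_adj m n k (I : {set 'I_m.+1}) (J : {set 'I_n.+1})
    (A : 'M[C]_(m.+1, n.+1)) :
  minor k J I (A ^t* ) = (minor k I J A)^*.
Proof.
rewrite /minor -det_map_mx -[in RHS]det_tr; congr (\det _).
by apply/matrixP => i j; rewrite !mxE.
Qed.

Lemma unitarymxC n (V : 'M[C]_n) : V \is unitarymx -> V^t* *m V = 1%:M.
Proof. by move=> /unitarymxP/mulmx1C. Qed.

(* The sum over all I is 1, and by Cauchy-Binet the sum over the I that avoid x
   is the determinant of 1 - v^* v, where v is row x of V restricted to J. *)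
Lemma sum_minor_row n k (V : 'M[C]_n.+1) (x : 'I_n.+1) (J : {set 'I_n.+1}) :
    V \is unitarymx -> #|J| = k ->
  \sum_(I : {set 'I_n.+1} | (#|I| == k) && (x \in I))
    minor k I J V * (minor k I J V)^* =
  \sum_(j in J) V x j * (V x j)^*.
Proof.
move=> Vu cJ.
have sumT : \sum_(I : {set 'I_n.+1} | #|I| == k)
    minor k I J V * (minor k I J V)^* = 1.
  transitivity (minor k J J (V^t* *m V)).
    by rewrite minorM; apply: eq_bigr => I _; rewrite minor_adj mulrC.
  by rewrite unitarymxC // minor1 // eqxx.
(* [diag_mx d] erases row [x], so it kills exactly the minors whose row set contains [x]. *)
pose d := \row_(i < n.+1) ((i != x)%:R : C).
have sumN : \sum_(I : {set 'I_n.+1} | (#|I| == k) && (x \notin I))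
    minor k I J V * (minor k I J V)^* =
    minor k J J (V^t* *m (diag_mx d *m V)).
  rewrite minorM big_mkcondr; apply: eq_bigr => I /eqP cI.
  rewrite minorM (bigD1 I) ?cI //= minor_diag // eqxx.
  rewrite [X in _ * (_ + X)]big1 => [|K /andP[/eqP cK neq_KI]]; last first.
    by rewrite minor_diag // eq_sym (negPf neq_KI) mul0r.
  rewrite addr0 minor_adj mulrCA; case: ifPn => [xI|].
    rewrite big1 ?mul1r 1?mulrC // => i iI.
    by rewrite mxE; case: eqP iI xI => // -> ->.
  by rewrite negbK => xI; rewrite (bigD1 x) //= mxE eqxx !mul0r.
(* Adding the complementary sum to both sides makes the left one equal to 1. *)
apply/eqP; rewrite -(inj_eq (addIr (minor k J J (V^t* *m (diag_mx d *m V))))).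
rewrite -sumN -bigID /= sumT sumN /minor.
have -> : mxsub (elt J) (elt J) (V^t* *m (diag_mx d *m V)) =
  1%:M - (\col_i (V x (elt J i))^*) *m (\row_i V x (elt J i)) :> 'M_k.
  have -> : diag_mx d = 1%:M - delta_mx x x.
    apply/matrixP => i j; rewrite !mxE.
    have [<-|neq_ij] := eqVneq i j.
      by rewrite andbb; case: eqP; rewrite ?subrr ?subr0.
    have [ix|_] := eqVneq i x; last by rewrite subr0.
    by rewrite -ix eq_sym (negPf neq_ij) subr0.
  rewrite mulmxBl mul1mx mulmxBr unitarymxC // mulmxA.
  apply/matrixP => i j; rewrite !mxE (inj_eq (elt_inj cJ)); congr (_ - _).
  rewrite big_ord1 !mxE (bigD1 x) //= !mxE (bigD1 x) //= !mxE !eqxx mulr1.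
  rewrite !big1 ?addr0 // => l /negPf lx; rewrite !mxE ?lx ?andbF ?mulr0 //.
  rewrite big1 ?mul0r // => l' _; rewrite !mxE lx andbF mulr0 //.
rewrite det_1_sub_colrow mxE -(sum_elt _ cJ).
by rewrite addrCA -[X in _ == _ + X]opprB -sumrB big1 ?oppr0 ?addr0 // => i _;
  rewrite !mxE subrr.
Qed.

(** Gram-Schmidt applied to the all-ones matrix still returns a unitary matrix. Its first row is
    proportional to the all-ones row, and normalisation fixes the modulus. *)
Lemma exists_flat_unitary n : exists2 B : 'M[C]_n.+1,
  B \is unitarymx & forall j, B 0 j * (B 0 j)^* = n.+1%:R^-1.
Proof.
pose A : 'M[C]_n.+1 := const_mx 1.
have Bu : schmidt A \is unitarymx by exact: schmidt_unitarymx.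
exists (schmidt A) => // j; set B := schmidt A in Bu *.
have /sub_rVP[a rowA] : (row 0 A <= row 0 B)%MS.
  apply: submx_trans (row_schmidt_sub A 0) _; apply/sumsmx_subP => k.
  by rewrite leqn0 genmxE => /eqP k0; rewrite (_ : k = 0) //; apply: val_inj.
have BE l : a * B 0 l = 1 by have /rowP/(_ l) := rowA; rewrite !mxE.
have a_neq0 : a != 0.
  apply/eqP => a0; move: (BE 0); rewrite a0 mul0r => /esym/eqP.
  by rewrite oner_eq0.
have {}BE l : B 0 l = a^-1 by rewrite -[LHS](mulKf a_neq0) BE mulr1.
have /unitarymxP/matrixP/(_ 0 0) := Bu; rewrite !mxE eqxx /=.
under eq_bigr do rewrite !mxE !BE.
rewrite sumr_const card_ord BE => normB.
have n_neq0 : n.+1%:R != 0 :> C by rewrite pnatr_eq0.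
by apply: (mulIf n_neq0); rewrite mulr_natr normB mulVf.
Qed.

(* The left-hand side is an entry of the adjugate of ['X - M], which is computed
   by conjugating the adjugate of the diagonal matrix ['X - diag_mx d]. *)
Lemma char_poly_compression m (B : 'M[C]_(1 + m)) (d : 'rV[C]_(1 + m)) :
    B \is unitarymx -> (forall j, B 0 j * (B 0 j)^* = m.+1%:R^-1) ->
  char_poly (drsubmx (B *m diag_mx d *m B^t*)) =
  m.+1%:R^-1 *: (\prod_i ('X - (d 0 i)%:P))^`().
Proof.
move=> Bu B0; set M := B *m _ *m _.
pose Bp := map_mx polyC B; pose Bq := map_mx polyC (B^t*).
have BpBq : Bp *m Bq = 1%:M by rewrite -map_mxM (unitarymxP Bu) map_mx1.
have BqBp : Bq *m Bp = 1%:M by exact: mulmx1C.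
pose X := diag_mx (\row_i ('X - (d 0 i)%:P)).
pose E := diag_mx (\row_j \prod_(i | i != j) ('X - (d 0 i)%:P)).
pose q := \prod_i ('X - (d 0 i)%:P).
have XE : X *m E = q%:M.
  rewrite mulmx_diag -diag_const_mx; congr diag_mx; apply/rowP => i.
  by rewrite !mxE /q [RHS](bigD1 i).
have ME : char_poly_mx M = Bp *m X *m Bq.
  have -> : X = 'X%:M - map_mx polyC (diag_mx d).
    apply/matrixP => i j; rewrite !mxE.
    by case: eqP => // _; rewrite !mulr0n polyC0 subrr.
  by rewrite mulmxBr mulmxBl scalar_mxC -(mulmxA 'X%:M) BpBq mulmx1 -!map_mxM.
have detM : \det (char_poly_mx M) = q.
  rewrite ME !det_mulmx mulrAC -det_mulmx BpBq det1 mul1r det_diag.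
  by apply: eq_bigr => i _; rewrite mxE.
have q_neq0 : q != 0 by apply/monic_neq0/monic_prod => i _; exact: monicXsubC.
(* Both sides agree after multiplication by [q], the determinant of [char_poly_mx M]. As a nonzero
   polynomial over a field, [q] cancels. *)
have adjE : \adj (char_poly_mx M) = Bp *m E *m Bq.
  apply/eqP; rewrite -subr_eq0; apply/eqP; set Z := _ - _.
  have : q *: Z = 0.
    rewrite -mul_scalar_mx -detM -mul_adj_mx -mulmxA mulmxBr mul_mx_adj.
    have -> : char_poly_mx M *m (Bp *m E *m Bq) = q%:M.
      rewrite ME -!mulmxA (mulmxA Bq) BqBp mul1mx (mulmxA X) XE.
      by rewrite -scalar_mxC mulmxA BpBq mul1mx.
    by rewrite detM subrr mulmx0.
  move=> /matrixP qZ0; apply/matrixP => i j; have := qZ0 i j.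
  by rewrite !mxE => /eqP; rewrite mulf_eq0 (negPf q_neq0) => /eqP.
transitivity ((\adj (char_poly_mx M)) 0 0).
  rewrite mxE /cofactor expr0 mul1r; congr (\det _).
  apply/matrixP => i j; rewrite !mxE.
  by rewrite !rshift1 (inj_eq lift_inj).
rewrite adjE deriv_prod scaler_sumr !mxE; apply: eq_bigr => j _.
by rewrite mul_mx_diag !mxE derivXsubC mul1r mulrAC -polyCM B0 mul_polyC.
Qed.

(** Schur's theorem yields the eigenvalues in an order of its own, while [mu] is listed arbitrarily.
    Here the diagonal follows [mu], and triangularity holds in the order transported by [s]. *)
Lemma trigonalize_compression m (d : 'rV[C]_m.+1) (mu : 'I_m -> C) :
    \prod_i ('X - (mu i)%:P) =
      m.+1%:R^-1 *: (\prod_i ('X - (d 0 i)%:P))^`() ->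
  exists V : 'M[C]_m.+1, exists s : 'S_m,
  let M := V *m diag_mx d *m V^t* in
  [/\ V \is unitarymx,
      forall j, V ord_max j * (V ord_max j)^* = m.+1%:R^-1,
      forall i, M (lift ord_max i) (lift ord_max i) = mu i &
      forall i j, (s i < s j)%N -> M (lift ord_max i) (lift ord_max j) = 0].
Proof.
move=> mu_roots.
have [B Bu B0] : exists2 B : 'M[C]_(1 + m), B \is unitarymx &
    forall j, B 0 j * (B 0 j)^* = m.+1%:R^-1 by exact: exists_flat_unitary.
have cB := char_poly_compression d Bu B0; rewrite -mu_roots in cB.
set M1 := drsubmx _ in cB.
have [P Pu Ptrig] : exists2 P : 'M[C]_m, P \is unitarymx &
    is_trig_mx (P *m M1 *m P^t*).
  (* [Schur] asks for a positive size, so the empty block is treated apart. *)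
  case: (posnP m) => [m0|m_gt0].
    exists 1%:M; first by apply/unitarymxP; rewrite trmx1 map_mx1 mulmx1.
    by apply/is_trig_mxP => i; have := leq_trans (ltn_ord i) (eq_leq m0).
  have [P Pu] := Schur M1 m_gt0; rewrite /similar_to conjymx // => Pt.
  by exists P.
set T := _ *m _ in Ptrig.
have cT : char_poly T = char_poly M1.
  rewrite /char_poly; pose Pp := map_mx polyC P; pose Pq := map_mx polyC (P^t*).
  have PpPq : Pp *m Pq = 1%:M by rewrite -map_mxM (unitarymxP Pu) map_mx1.
  have -> : char_poly_mx T = Pp *m char_poly_mx M1 *m Pq.
    by rewrite mulmxBr mulmxBl scalar_mxC -(mulmxA 'X%:M) PpPq mulmx1 -!map_mxM.
  by rewrite !det_mulmx mulrAC -det_mulmx PpPq det1 mul1r.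
(* Both families have the same product of linear factors, namely the characteristic polynomial of
   the compression. *)
have /tuple_permP[s mu_s] : perm_eq [tuple mu i | i < m] [tuple T i i | i < m].
  apply: prod_XsubC_eq; rewrite !big_map -enumT !big_enum /=.
  by rewrite -cB -cT char_poly_trig.
have {}mu_s i : mu i = T (s i) (s i).
  have := congr1 (fun u => nth 0 u i) mu_s.
  by rewrite -!tnth_nth !tnth_mktuple.
(* [V0] keeps the flat row first and triangularises the complement; [tau] then moves the flat row to
   the end and sorts the others so that the diagonal reads [mu]. *)
pose V0 : 'M[C]_(1 + m) := block_mx 1%:M 0 0 P *m B.
pose tau (i : 'I_m.+1) : 'I_(1 + m) :=
  if unlift ord_max i is Some j then rshift 1 (s j) else 0.
have tau_inj : injective tau.
  move=> i j; rewrite /tau.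
  case: unliftP => [i' ->|->]; case: unliftP => [j' ->|->] //.
  by move/rshift_inj/perm_inj->.
have V0u : V0 \is unitarymx.
  apply: mul_unitarymx => //; apply/unitarymxP.
  rewrite tr_block_mx map_block_mx mulmx_block !trmx0 !map_mx0 trmx1 map_mx1.
  rewrite !(mulmx0, mul0mx, addr0, add0r) mulmx1 (unitarymxP Pu).
  by rewrite -scalar_mx_block.
pose V := rowsub tau V0.
have VE (D : 'M_m.+1) : V *m D *m V^t* = mxsub tau tau (V0 *m D *m V0^t*).
  rewrite /V !mul_rowsub_mx; apply/matrixP => i j; rewrite !mxE.
  by apply: eq_bigr => l _; rewrite !mxE.
have MT i j : (V *m diag_mx d *m V^t*) (lift ord_max i) (lift ord_max j) =
    T (s i) (s j).
  rewrite VE mxE /tau !liftK.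
  have -> : V0 *m diag_mx d *m V0^t* = block_mx 1%:M 0 0 P *m
     (B *m diag_mx d *m B^t*) *m (block_mx 1%:M 0 0 P)^t*.
    by rewrite /V0 trmx_mul map_mxM !mulmxA.
  rewrite -[B *m _ *m _]submxK tr_block_mx map_block_mx !mulmx_block.
  rewrite !trmx0 !map_mx0 !(mulmx0, mul0mx, addr0, add0r) /=.
  by rewrite block_mxEdr.
exists V, s; split=> [|j|i|i j s_lt].
- apply/unitarymxP; have := VE 1%:M; rewrite !mulmx1 => ->.
  rewrite (unitarymxP V0u); apply/matrixP => i j.
  by rewrite !mxE (inj_eq tau_inj).
- suff V0B : V0 0 j = B 0 j by rewrite mxE /tau unlift_none V0B B0.
  rewrite /V0 -[B]vsubmxK mul_block_col mul1mx mul0mx addr0.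
  by rewrite (_ : 0 = lshift m (0 : 'I_1)) ?col_mxEu //; apply: val_inj.
- by rewrite MT mu_s.
- by rewrite MT; move/is_trig_mxP: Ptrig; apply.
Qed.

End Unitary.

(** * Principal minors computed in two ways *)

Lemma minor_unitary_diag (C : numClosedFieldType) n k (I : {set 'I_n.+1})
    (V : 'M[C]_n.+1) (d : 'rV[C]_n.+1) :
  minor k I I (V *m diag_mx d *m V^t*) =
  \sum_(K : {set 'I_n.+1} | #|K| == k)
    minor k I K V * (minor k I K V)^* * \prod_(j in K) d 0 j.
Proof.
rewrite minorM; apply: eq_bigr => K /eqP cK; rewrite minor_adj minorM.
rewrite (bigD1 K) ?cK //= minor_diag // eqxx.
rewrite [X in _ + X]big1 => [|L /andP[/eqP cL neq_LK]].
  by rewrite addr0 mulrAC.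
by rewrite minor_diag // (negPf neq_LK) mulr0.
Qed.

(** [elt] lists [I] in increasing order, in which the submatrix need not be triangular; ranking its
    rows by [s] lets [det_rank_trig] apply. *)
Lemma minor_lift_trig (R : comPzRingType) m k (M : 'M[R]_m.+1) (s : 'S_m)
    (J : {set 'I_m}) (I := [set lift ord_max j | j in J]) :
    (forall i j, (s i < s j)%N -> M (lift ord_max i) (lift ord_max j) = 0) ->
    #|J| = k ->
  minor k I I M = \prod_(j in J) M (lift ord_max j) (lift ord_max j).
Proof.
move=> M0 cJ; have cI : #|I| = k by rewrite card_imset //; exact: lift_inj.
have eltI (i : 'I_k) : exists j, elt I i = lift ord_max j.
  by have /imsetP[j _ ->] := mem_elt i cI; exists j.
(* The default 0 is never taken, since [I] avoids [ord_max]. *)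
pose r (i : 'I_k) : nat := if unlift ord_max (elt I i) is Some j then s j else 0.
have rE i j : elt I i = lift ord_max j -> r i = s j.
  by rewrite /r => ->; rewrite liftK.
rewrite /minor (@det_rank_trig _ _ _ r) => [|i i'|i i'].
- under eq_bigr do rewrite mxE; rewrite (prod_elt (fun j => M j j) cI).
  by rewrite big_imset //= => ? ? _ _; exact: lift_inj.
- have [[j ej] [j' ej']] := (eltI i, eltI i').
  rewrite (rE _ _ ej) (rE _ _ ej') => /val_inj/perm_inj eq_j.
  by apply: (elt_inj cI); rewrite ej ej' eq_j.
- have [[j ej] [j' ej']] := (eltI i, eltI i').
  by rewrite (rE _ _ ej) (rE _ _ ej') mxE ej ej' => /M0.
Qed.

(** * Listings of [k]-subsets *)

Lemma big_ksubset_listing (R : nmodType) N k (e : 'I_'C(N, k) -> {set 'I_N})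
    (P : pred {set 'I_N}) (F : {set 'I_N} -> R) :
    ksubset_listing e ->
  \sum_(i | P (e i)) F (e i) = \sum_(A : {set 'I_N} | (#|A| == k) && P A) F A.
Proof.
case=> e_inj e_onto; rewrite [LHS]big_mkcond [RHS]big_mkcondr /=.
have -> : \sum_(A : {set 'I_N} | #|A| == k) (if P A then F A else 0) =
   \sum_(A in [set e i | i : 'I_'C(N, k)]) (if P A then F A else 0).
  apply: eq_bigl => A; apply/eqP/imsetP => [/e_onto[i <-]|[i _ ->]].
    by exists i.
  by apply/e_onto; exists i.
by rewrite big_imset // => i j _ _; exact: e_inj.
Qed.

(** This listing will index the rows of [S_k]: the rows kept by the projection follow [eM], and the
    rows of the prescribed sum are the subsets that contain the flat row. *)
Lemma ksubset_listing_extend m k (eM : 'I_'C(m, k) -> {set 'I_m}) :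
    ksubset_listing eM ->
  exists eR : 'I_'C(m.+1, k) -> {set 'I_m.+1},
  [/\ ksubset_listing eR,
      forall (i : 'I_'C(m.+1, k)) (j : 'I_'C(m, k)), i = j :> nat ->
        eR i = [set lift ord_max l | l in eM j] &
      forall i : 'I_'C(m.+1, k), (ord_max \in eR i) = ('C(m, k) <= i)%N].
Proof.
case=> eM_inj eM_onto; pose lft (J : {set 'I_m}) := [set lift ord_max l | l in J].
have lft_inj : injective lft by apply: imset_inj; exact: lift_inj.
have max_lft J : ord_max \notin lft J.
  by apply/imsetP => -[l _ /eqP]; rewrite (negPf (neq_lift _ _)).
pose L1 := [seq lft (eM j) | j <- enum 'I_'C(m, k)].
pose L2 := enum [set A : {set 'I_m.+1} | (#|A| == k) && (ord_max \in A)].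
have sL1 : size L1 = 'C(m, k) by rewrite size_map size_enum_ord.
have uL : uniq (L1 ++ L2).
  rewrite cat_uniq enum_uniq map_inj_uniq ?enum_uniq ?andbT;
    last by move=> i j /lft_inj/eM_inj.
  apply/hasPn => A; rewrite mem_enum inE => /andP[_ maxA].
  by apply/mapP => -[j _ eqA]; rewrite eqA (negPf (max_lft _)) in maxA.
have memL A : (A \in L1 ++ L2) = (#|A| == k).
  rewrite mem_cat mem_enum inE; case: (boolP (ord_max \in A)) => maxA.
    rewrite andbT orb_idl // => /mapP[j _ eqA].
    by rewrite eqA (negPf (max_lft _)) in maxA.
  rewrite andbF orbF; have lftA : A = lft [set l | lift ord_max l \in A].
    apply/setP => x; apply/idP/imsetP => [xA|[l]]; last by rewrite inE => ? ->.
    case: (unliftP ord_max x) xA => [l ->|->] xA; first by exists l; rewrite ?inE.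
    by rewrite xA in maxA.
  apply/mapP/eqP => [[j _ ->]|cA].
    by rewrite card_imset; [apply/eM_onto; exists j | exact: lift_inj].
  have /eM_onto[j ej] : #|[set l | lift ord_max l \in A]| = k.
    by rewrite -cA [in RHS]lftA card_imset //; exact: lift_inj.
  by exists j; rewrite ?mem_enum // ej.
(* The list is duplicate-free and its members are exactly the [k]-subsets, so counting these gives
   its length. *)
have sL : size (L1 ++ L2) = 'C(m.+1, k).
  rewrite -(card_uniqP uL) -[in RHS](card_ord m.+1) -card_draws.
  by apply: eq_card => A; rewrite memL inE.
exists (fun i => nth set0 (L1 ++ L2) i); split.
- split=> [i j /eqP|A].
    by rewrite nth_uniq ?sL // => /eqP/val_inj.
  split=> [/eqP|[i <-]]; last by apply/eqP; rewrite -memL mem_nth ?sL.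
  rewrite -memL => AL; have := AL; rewrite -index_mem sL => lt_i.
  by exists (Ordinal lt_i); rewrite nth_index.
- move=> i j ->; rewrite nth_cat sL1 ltn_ord (nth_map j) ?size_enum_ord //.
  by rewrite nth_ord_enum.
move=> i; rewrite nth_cat sL1 [RHS]leqNgt; case: ltnP => [lt_i|ge_i] /=.
  by rewrite (nth_map (Ordinal lt_i)) ?size_enum_ord // (negPf (max_lft _)).
have : nth set0 L2 (i - 'C(m, k)) \in L2.
  by rewrite mem_nth // -(ltn_add2l (size L1)) -size_cat sL sL1 subnKC.
by rewrite mem_enum inE => /andP[].
Qed.

(** * Roots of a polynomial and of its derivative *)

(** Over a closed field [q] splits, and equal multiplicities make its list of roots a permutation of
    the values of [z]. *)
Lemma roots_with_mult_prod (R : realType) (q : {poly R[i]}) N (z : 'I_N -> R[i]) :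
    q != 0 -> roots_with_mult q z ->
  q = lead_coef q *: \prod_i ('X - (z i)%:P).
Proof.
move=> q_neq0 hz; have [r qE] := closed_field_poly_normal q.
rewrite {1}qE; congr (_ *: _).
have -> : \prod_i ('X - (z i)%:P) = \prod_(x <- codom z) ('X - x%:P).
  by rewrite big_image.
apply: perm_big; apply/allP => x _ /=; apply/eqP.
have c_neq0 : lead_coef q != 0 by rewrite lead_coef_eq0.
transitivity (mup x q).
  by rewrite qE -mul_polyC mupMr ?rootC // mu_prod_XsubC.
rewrite -hz /codom /image_mem count_map cardE /enum_mem size_filter count_filter.
by apply: eq_count => j; rewrite /= inE andbT.
Qed.

Lemma prod_XsubC_deriv (R : realType) m (p : {poly R[i]})
    (lambda : 'I_m.+1 -> R[i]) (mu : 'I_m -> R[i]) :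
    p != 0 -> roots_with_mult p lambda -> roots_with_mult p^`() mu ->
  \prod_i ('X - (mu i)%:P) =
  m.+1%:R^-1 *: (\prod_i ('X - (lambda i)%:P))^`().
Proof.
move=> p_neq0 hl hm; set Q := \prod_i ('X - (lambda i)%:P).
have pE : p = lead_coef p *: Q by exact: roots_with_mult_prod.
have coefM N (z : 'I_N -> R[i]) : (\prod_i ('X - (z i)%:P))`_N = 1.
  have sz : size (\prod_i ('X - (z i)%:P)) = N.+1.
    by rewrite size_prod_XsubC /index_enum -enumT size_enum_ord.
  have /monicP := monic_prod_XsubC (index_enum 'I_N) predT z.
  by rewrite lead_coefE sz.
have coefQ : Q^`()`_m = m.+1%:R by rewrite coef_deriv coefM.
have n_neq0 : m.+1%:R != 0 :> R[i] by rewrite pnatr_eq0.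
(* Its coefficient of degree [m] is [m.+1] times the leading coefficient of [p], nonzero in
   characteristic 0. *)
have dp_neq0 : p^`() != 0.
  apply/eqP => /(congr1 (fun q : {poly _} => q`_m)).
  rewrite pE derivZ coefZ coefQ coef0 => /eqP.
  by rewrite mulf_eq0 lead_coef_eq0 (negPf p_neq0) (negPf n_neq0).
have dpE := roots_with_mult_prod dp_neq0 hm.
set c := lead_coef _ in dpE.
have c_neq0 : c != 0 by rewrite lead_coef_eq0.
have cE : c = lead_coef p * m.+1%:R.
  have := congr1 (fun q : {poly _} => q`_m) dpE.
  by rewrite {1}pE derivZ !coefZ coefQ coefM mulr1.
apply: (scalerI c_neq0); rewrite -dpE {1}pE derivZ scalerA cE -mulrA.
by rewrite mulfV // mulr1.
Qed.

(** * Unitary-stochastic matrices and conclusion *)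

Lemma unitary_stochastic_of_unitary (R : realType) N (U : 'M[R[i]]_N) :
    U \is unitarymx ->
  exists2 S : 'M[R]_N, unitary_stochastic S &
    forall i j, real_complex R (S i j) = U i j * (U i j)^*.
Proof.
move=> Uu; pose S := \matrix_(i, j) complex.Re (U i j * (U i j)^*).
have SE i j : real_complex R (S i j) = U i j * (U i j)^*.
  by rewrite mxE RRe_real // ger0_real // mul_conjC_ge0.
exists S => //; exists U => //; apply/matrixP => i j.
by rewrite mxE SE !mxE.
Qed.

(** Rows and columns have separate listings because the column order is imposed by [eN], while the
    row order must extend [eM]. *)
Lemma minor_matrix_unitary (C : numClosedFieldType) n k (V : 'M[C]_n.+1)
    (e f : 'I_'C(n.+1, k) -> {set 'I_n.+1}) :
    V \is unitarymx -> ksubset_listing e -> ksubset_listing f ->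
  (\matrix_(i, j) minor k (e i) (f j) V) \is unitarymx.
Proof.
move=> Vu [e_inj e_onto] lf; apply/unitarymxP/matrixP => i i'; rewrite !mxE.
under eq_bigr do rewrite !mxE -minor_adj.
have cd l : #|e l| = k by apply/e_onto; exists l.
rewrite (big_ksubset_listing predT
  (fun K => minor k (e i) K V * minor k K (e i') (V^t*)) lf).
rewrite (eq_bigl (fun K : {set 'I_n.+1} => #|K| == k)) => [|K];
  last by rewrite andbT.
by rewrite -minorM (unitarymxP Vu) minor1 // (inj_eq e_inj).
Qed.

Theorem theorem4p3 (R : realType) (n : nat) (hn : (2 <= n)%N)
    (p : {poly R[i]}) (hp : size p = n.+1)
    (lambda : 'I_n -> R[i]) (hlambda : roots_with_mult p lambda)
    (mu : 'I_n -> R[i])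
    (hmu : roots_with_mult p^`()
             (fun j : 'I_n.-1 => mu (widen_ord (leq_pred n) j)))
    (hmun : forall j : 'I_n, val j = n.-1 ->
              mu j = n%:R^-1 * \sum_(i < n) lambda i) :
  (forall (k : nat), (1 <= k <= n.-1)%N ->
   forall (eN : 'I_'C(n, k) -> {set 'I_n})
          (eM : 'I_'C(n.-1, k) -> {set 'I_n.-1}),
   ksubset_listing eN -> ksubset_listing eM ->
   exists S : 'M[R]_('C(n, k)),
     [/\ unitary_stochastic S,
         (forall j : 'I_'C(n, k),
            \sum_(i < 'C(n, k) | ('C(n.-1, k) <= i)%N) S i j = k%:R / n%:R)
       & forall alpha : R[i],
           compound eM (fun j => mu (widen_ord (leq_pred n) j) - alpha) =
           (pid_mx 'C(n.-1, k) : 'M[R[i]]_('C(n.-1, k), 'C(n, k)))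
             *m map_mx (real_complex R) S
             *m compound eN (fun j => lambda j - alpha)])
  /\
  (exists S : 'M[R]_n,
     [/\ unitary_stochastic S,
         (forall i j : 'I_n, val i = n.-1 -> S i j = n%:R^-1)
       & \col_j mu j = map_mx (real_complex R) S *m \col_j lambda j]).
Proof.
have p_neq0 : p != 0 by rewrite -size_poly_eq0 hp.
case: n hn hp lambda hlambda mu hmu hmun => // m _ _ lambda hlambda mu.
rewrite -[m.+1.-1]/m => hmu hmun.
have widenE (j : 'I_m) : widen_ord (leq_pred m.+1) j = lift ord_max j.
  by apply: val_inj; exact: esym (lift_max j).
pose nu j := mu (lift ord_max j).
have muE j : mu (widen_ord (leq_pred m.+1) j) = nu j by rewrite widenE.
have hnu : roots_with_mult p^`() nu.
  by move=> x; rewrite -hmu; apply: eq_card => j; rewrite !inE muE.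
pose d := \row_i lambda i.
have nu_roots : \prod_i ('X - (nu i)%:P) =
    m.+1%:R^-1 *: (\prod_i ('X - (d 0 i)%:P))^`().
  rewrite (prod_XsubC_deriv p_neq0 hlambda hnu).
  by under [in RHS]eq_bigr do rewrite mxE.
have [V [s /= [Vu Vmax Vdiag Vtrig]]] := trigonalize_compression nu_roots.
have natC N : real_complex R N%:R = N%:R by rewrite rmorph_nat.
have natVC N : real_complex R N%:R^-1 = N%:R^-1.
  by rewrite -[in RHS]natC; exact: (fmorphV (real_complex R)).
split=> [k /andP[k_gt0 le_km] eN eM leN leM|]; last first.
  (* The last claim uses [V] itself: the diagonal of the conjugated matrix gives the critical
     points, and the flat last row gives the mean. *)
  have [S Sst SE] := unitary_stochastic_of_unitary Vu.
  exists S; split=> // [i j im|].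
    have -> : i = ord_max by apply: val_inj.
    by apply: (@complexI R); rewrite SE Vmax natVC.
  apply/colP => i; rewrite !mxE; under eq_bigr do rewrite !mxE SE.
  case: (unliftP ord_max i) => [j ->|->]; last first.
    rewrite hmun // mulr_sumr; apply: eq_bigr => j _.
    by rewrite Vmax.
  rewrite -[LHS]Vdiag mxE; apply: eq_bigr => l _.
  by rewrite mul_mx_diag !mxE mulrAC.
have [eR [leR eRM eRmax]] := ksubset_listing_extend leM.
have cR i : #|eR i| = k by case: leR => _ onto; apply/onto; exists i.
have cN i : #|eN i| = k by case: leN => _ onto; apply/onto; exists i.
have cM i : #|eM i| = k by case: leM => _ onto; apply/onto; exists i.
have Uu := minor_matrix_unitary Vu leR leN.
have [S Sst SE] := unitary_stochastic_of_unitary Uu.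
exists S; split=> // [j|alpha].
  have knE : real_complex R (k%:R / m.+1%:R) = k%:R / m.+1%:R.
    by rewrite -[k%:R in RHS]natC -natVC; exact: (rmorphM (real_complex R)).
  apply: (@complexI R); rewrite knE rmorph_sum /=.
  under eq_bigr do rewrite SE !mxE.
  under eq_bigl do rewrite -eRmax.
  rewrite (big_ksubset_listing (fun A => ord_max \in A)
    (fun A => minor k A (eN j) V * (minor k A (eN j) V)^*) leR) /=.
  (* What remains is a sum of [k] squared moduli from the flat row, each equal to [1/n]. *)
  rewrite (sum_minor_row ord_max Vu (cN j)).
  under eq_bigr do rewrite Vmax.
  by rewrite sumr_const cN [RHS]mulr_natl.
apply/colP => i; rewrite -mulmxA !mxE.
have le_C : ('C(m, k) <= 'C(m.+1, k))%N by rewrite leq_bin2l.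
(* Column [wi] holds the only nonzero entry of row [i] of [pid_mx]. *)
pose wi := widen_ord le_C i.
rewrite [RHS](bigD1 wi) //= [X in _ + X]big1 ?addr0 => [|l neq_l]; last first.
  rewrite !mxE; case: eqP => [il|]; last by rewrite mul0r.
  by case/eqP: neq_l; apply: val_inj.
rewrite !mxE /= eqxx ltn_ord mul1r.
under eq_bigr do rewrite muE.
pose da := \row_j (lambda j - alpha).
(* Conjugation fixes scalar matrices, so one [V], hence one [S], serves every [alpha]. *)
have daE : V *m diag_mx da *m V^t* = V *m diag_mx d *m V^t* - alpha%:M.
  have -> : diag_mx da = diag_mx d - alpha%:M.
    by apply/matrixP => a b; rewrite !mxE -mulrnBl.
  by rewrite mulmxBr mulmxBl scalar_mxC -(mulmxA alpha%:M) (unitarymxP Vu) mulmx1.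
transitivity (minor k (eR wi) (eR wi) (V *m diag_mx da *m V^t*)).
  rewrite (eRM wi i) // (minor_lift_trig (s := s)) // => [|a b lt_ab].
    by apply: eq_bigr => j _; rewrite daE mxE Vdiag !mxE eqxx.
  rewrite daE mxE Vtrig // !mxE (inj_eq lift_inj).
  by case: eqP lt_ab => [->|]; rewrite ?ltnn ?subr0.
rewrite minor_unitary_diag.
transitivity (\sum_(K : {set 'I_m.+1} | (#|K| == k) && predT K)
    minor k (eR wi) K V * (minor k (eR wi) K V)^* * \prod_(j in K) da 0 j).
  by apply: eq_bigl => K; rewrite andbT.
rewrite -(big_ksubset_listing predT (fun K => minor k (eR wi) K V *
  (minor k (eR wi) K V)^* * \prod_(j in K) da 0 j) leN).
apply: eq_bigr => j _; rewrite !mxE SE !mxE.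
by under eq_bigr do rewrite mxE.
Qed.
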